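(* Let $A$ be a unital alternative $*$-algebra over $\mathbb{C}$ with unit $1_A$, and let $n\ge 2$ be a fixed integer. Assume that $A$ contains a nontrivial symmetric idempotent $e$ (i.e. $e^2=e=e^*$, $e\neq 0$, $e\neq 1_A$) such that (i) if $x\in A$ and $(xa)e=0$ for all $a\in A$, then $x=0$; and (ii) if $x\in A$ and $(xa)(1_A-e)=0$ for all $a\in A$, then $x=0$. If a (not necessarily additive) map $\Phi:A\to A$ satisfies $$\Phi(a_1\bullet a_2\bullet\cdots\bullet a_n)=\sum_{k=1}^{n} a_1\bullet\cdots\bullet a_{k-1}\bullet\Phi(a_k)\bullet a_{k+1}\bullet\cdots\bullet a_n$$ for all $a_{n-1},a_n\in A$ and $a_i=1_A$ for all $i\in\{1,\dots,n-2\}$, then $\Phi$ is an additive $*$-derivation.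
   Context: An algebra $A$ (not necessarily associative) is alternative if $a^2b=a(ab)$ and $ba^2=(ba)a$ for all $a,b\in A$. An involution on $A$ is a map $*:A\to A$ with $(x+y)^*=x^*+y^*$, $(x^* )^*=x$, $(xy)^*=y^*x^*$; an alternative $*$-algebra is an alternative algebra with an involution. For $a,b\in A$ the Jordan $*$-product is $a\bullet b=ab+ba^*$, and iterated products are left-normed: $a_1\bullet a_2\bullet\cdots\bullet a_n=(\cdots((a_1\bullet a_2)\bullet a_3)\cdots)\bullet a_n$. A map $\Phi:A\to A$ is an additive $*$-derivation if $\Phi(a+b)=\Phi(a)+\Phi(b)$, $\Phi(ab)=\Phi(a)b+a\Phi(b)$ and $\Phi(a^* )=\Phi(a)^*$ for all $a,b\in A$. *)

(* Defs.v *)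
From HB Require Import structures.
From mathcomp Require Import all_boot all_order all_algebra all_field.
Set Implicit Arguments. Unset Strict Implicit. Unset Printing Implicit Defensive.
Import GRing.Theory.
Local Open Scope ring_scope.

Record alt_star_algebra (A : lmodType algC) := AltStarAlgebra {
  amul : A -> A -> A;
  aone : A;
  astar : A -> A;
  amulDl : forall x y z, amul (x + y) z = amul x z + amul y z;
  amulDr : forall x y z, amul x (y + z) = amul x y + amul x z;
  amulZl : forall (c : algC) x y, amul (c *: x) y = c *: amul x y;
  amulZr : forall (c : algC) x y, amul x (c *: y) = c *: amul x y;
  amul1l : forall x, amul aone x = x;
  amul1r : forall x, amul x aone = x;
  alt_left : forall a b, amul (amul a a) b = amul a (amul a b);
  alt_right : forall a b, amul b (amul a a) = amul (amul b a) a;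
  astarD : forall x y, astar (x + y) = astar x + astar y;
  astarK : forall x, astar (astar x) = x;
  astarM : forall x y, astar (amul x y) = amul (astar y) (astar x)
}.

Section Ops.
Variables (A : lmodType algC) (S : alt_star_algebra A).

Definition jprod (a b : A) : A := amul S a b + amul S b (astar S a).

Definition jprodn (n : nat) (a : nat -> A) : A :=
  foldl jprod (a 0%N) [seq a i | i <- iota 1 n.-1].

Definition additive_star_derivation (Phi : A -> A) : Prop :=
  (forall a b, Phi (a + b) = Phi a + Phi b) /\
  (forall a b, Phi (amul S a b) = amul S (Phi a) b + amul S a (Phi b)) /\
  (forall a, Phi (astar S a) = astar S (Phi a)).
End Ops.

(* Main.v *)
(* Since 1 • x = 2x, the hypothesis says that, up to a factor N = 2^(n-2),
   Phi (x • y) = (T • x) • y + Phi x • y + x • Phi y, where T is a combination of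
   t = Phi 1 and its adjoint.  The extra term is biadditive, so it cancels in the
   defect D(x, y) = Phi (x + y) - Phi x - Phi y, which therefore satisfies
   D(x • y, x • z) = x • D(y, z) and D(x • z, y • z) = D(x, y) • z; evaluating
   these on Peirce components gives D = 0.  Once Phi is additive, y = 1 and x = 1
   force t to be skew and to commute with everything, so the T-term vanishes, and
   comparing e • x with x • e for x = a + a^* gives t e = t (1 - e) = 0.
   Finally E(x, y) = Phi (x y) - Phi x y - x Phi y satisfies E(y, x^* ) = - E(x, y),
   and its coboundary measures the failure of Phi to be a derivation of the
   associator, hence is alternating.  This gives E(e, -) = 0, so E obeys the same
   Peirce multiplication rules as the product, and the twist E(y, x^* ) = - E(x, y)
   puts E of two components into two different Peirce spaces, except on A_11 and
   A_22, where hypotheses (i) and (ii) conclude. *)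
Require Import Defs.
From HB Require Import structures.
From mathcomp Require Import all_boot all_order all_algebra all_field.
Import GRing.Theory.
Local Open Scope ring_scope.

(** * Reflexive decision of identities between integer combinations in an abelian group *)

Inductive zexp :=
  ZVar of nat | ZZero | ZAdd of zexp & zexp | ZOpp of zexp | ZMuln of zexp & nat.

Fixpoint zeval (V : zmodType) (env : seq V) (u : zexp) : V :=
  match u with
  | ZVar i => env`_i
  | ZZero => 0
  | ZAdd u v => zeval V env u + zeval V env v
  | ZOpp u => - zeval V env u
  | ZMuln u n => zeval V env u *+ n
  end.

Fixpoint zcoef (u : zexp) (i : nat) : int :=
  match u with
  | ZVar j => (j == i)%:Z
  | ZZero => 0
  | ZAdd u v => zcoef u i + zcoef v i
  | ZOpp u => - zcoef u i
  | ZMuln u n => zcoef u i * n%:Z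
  end.

Lemma zevalE (V : zmodType) (env : seq V) (u : zexp) :
  zeval V env u = \sum_(i < size env) env`_i *~ zcoef u i.
Proof.
elim: u => [j||u IHu v IHv|u IHu|u IHu n] /=.
- have [lt_j|ge_j] := ltnP j (size env).
    rewrite (bigD1 (Ordinal lt_j)) //= eqxx mulr1z big1 ?addr0 // => i ne_ij.
    by rewrite (_ : (j == i) = false) ?mulr0z // eq_sym; apply/negbTE.
  (* A variable beyond the end of [env] takes the default value 0, and no summand matches it. *)
  rewrite nth_default // big1 // => i _.
  by rewrite (_ : (j == i) = false) ?mulr0z // gtn_eqF // (leq_trans _ ge_j).
- by rewrite big1 // => i _; rewrite mulr0z.
- by rewrite IHu IHv -big_split; apply: eq_bigr => i _; rewrite mulrzDr.
- by rewrite IHu -sumrN; apply: eq_bigr => i _; rewrite mulrNz.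
by rewrite IHu -sumrMnl; apply: eq_bigr => i _; rewrite mulrzA pmulrn.
Qed.

(** Turns a group identity into a boolean test on coefficients, which [zmod] settles by
    computation. *)
Lemma zmod_correct (V : zmodType) (env : seq V) (u v : zexp) :
  all (fun i => zcoef u i == zcoef v i) (iota 0 (size env)) ->
  zeval V env u = zeval V env v.
Proof.
move=> /allP eq_uv; rewrite !zevalE; apply: eq_bigr => i _.
by rewrite (eqP (eq_uv i _)) // mem_iota /=.
Qed.

(* Multiples are compared up to the instance path of their nmodule structure. *)
Ltac zindex x env :=
  lazymatch env with
  | x :: _ => constr:(0%N)
  | ?y :: ?env' =>
    lazymatch constr:((x, y)) with
    | (?u *+ ?n, ?u *+ ?n) => constr:(0%N)
    | _ => let i := zindex x env' in constr:(i.+1)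
    end
  end.
Ltac zliteral n :=
  lazymatch n with
  | O => constr:(tt) | S ?m => zliteral m
  | nat_of_bool true => constr:(tt) | nat_of_bool false => constr:(tt)
  end.
Ltac zatom env t :=
  match env with
  | _ => let _ := zindex t env in env
  | _ => constr:(t :: env)
  end.
Ltac zatoms env t :=
  lazymatch t with
  | 0 => env
  | ?u + ?v => let env' := zatoms env u in zatoms env' v
  | - ?u => zatoms env u
  | ?u *+ ?n => match n with
                | _ => let _ := zliteral n in zatoms env u
                | _ => zatom env t
                end
  | _ => zatom env t
  end.
Ltac zreify env t :=
  lazymatch t with
  | 0 => constr:(ZZero)
  | ?u + ?v => let u' := zreify env u in let v' := zreify env v in
               constr:(ZAdd u' v')
  | - ?u => let u' := zreify env u in constr:(ZOpp u')
  | ?u *+ ?n => match n with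
                | _ => let _ := zliteral n in
                       let u' := zreify env u in constr:(ZMuln u' n)
                | _ => let i := zindex t env in constr:(ZVar i)
                end
  | _ => let i := zindex t env in constr:(ZVar i)
  end.
Ltac zmod :=
  lazymatch goal with
  | |- @eq ?T ?u ?v =>
    let env := zatoms (@nil T) u in let env := zatoms env v in
    let u' := zreify env u in let v' := zreify env v in
    exact: (@zmod_correct _ env u' v' (erefl true))
  end.

(** * Elementary rules for the two products, and the alternating associator *)

Section Algebra.
Variables (A : lmodType algC) (S : alt_star_algebra A).

Notation "x · y" := (amul S x y) (at level 40, left associativity).
Notation "x • y" := (jprod S x y) (at level 40, left associativity).
Notation "x ^s" := (astar S x) (at level 2, format "x ^s").
Notation one := (aone S).

Lemma mulrn_inj0 (n : nat) (x : A) : (0 < n)%N -> x *+ n = 0 -> x = 0.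
Proof.
move=> n0 /eqP; rewrite -scaler_nat scaler_eq0 => /orP[|/eqP //].
by rewrite Num.Theory.pnatr_eq0 -leqn0 leqNgt n0.
Qed.

(** The usual way to exploit an equation below: a positive multiple of the wanted difference is
    exhibited as the difference of its sides. A complex vector space has no torsion. *)
Lemma zlin n (u v l r : A) : (0 < n)%N -> l = r -> (u - v) *+ n = l - r -> u = v.
Proof.
move=> n0 ->; rewrite subrr => /(mulrn_inj0 n _ n0) /eqP.
by rewrite subr_eq0 => /eqP.
Qed.

Lemma eqD (u v l r : A) : u = v -> l = r -> u + l = v + r.
Proof. by move=> -> ->. Qed.
Lemma eqB (u v l r : A) : u = v -> l = r -> u - l = v - r.
Proof. by move=> -> ->. Qed.

Lemma amul0l x : 0 · x = 0.
Proof. by have := amulZl S 0 0 x; rewrite !scale0r. Qed.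
Lemma amul0r x : x · 0 = 0.
Proof. by have := amulZr S 0 x 0; rewrite !scale0r. Qed.
Lemma amulNl x y : (- x) · y = - (x · y).
Proof. by rewrite -scaleN1r amulZl scaleN1r. Qed.
Lemma amulNr x y : x · (- y) = - (x · y).
Proof. by rewrite -scaleN1r amulZr scaleN1r. Qed.
Lemma amulMnl n x y : (x *+ n) · y = (x · y) *+ n.
Proof. by rewrite -!scaler_nat amulZl. Qed.
Lemma amulMnr n x y : x · (y *+ n) = (x · y) *+ n.
Proof. by rewrite -!scaler_nat amulZr. Qed.
Lemma astar0 : 0^s = 0.
Proof. by apply: (@addrI _ (0^s)); rewrite -astarD !addr0. Qed.
Lemma astarN x : (- x)^s = - x^s.
Proof. by apply: (@addrI _ (x^s)); rewrite -astarD !subrr astar0. Qed.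
Lemma astarMn n x : (x *+ n)^s = x^s *+ n.
Proof. by elim: n => [|n IHn]; rewrite ?astar0 // !mulrS astarD IHn. Qed.
Lemma astar1 : one^s = one.
Proof. by rewrite -[LHS](amul1l S) -{1}[one](astarK S) -astarM amul1l astarK. Qed.

Definition mulE := (amulDl, amulDr, amulNl, amulNr, amulMnl, amulMnr,
  amul0l, amul0r, amul1l, amul1r, astarD, astarN, astarMn, astar0, astar1,
  astarK, astarM).

Lemma jprodE x y : x • y = x · y + y · x^s. Proof. by []. Qed.
Lemma jprodDl x y z : (x + y) • z = x • z + y • z.
Proof. by rewrite !jprodE !mulE; zmod. Qed.
Lemma jprodDr x y z : x • (y + z) = x • y + x • z.
Proof. by rewrite !jprodE !mulE; zmod. Qed.
Lemma jprodMnl n x y : (x *+ n) • y = (x • y) *+ n.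
Proof. by rewrite !jprodE !mulE mulrnDl. Qed.
Lemma jprodMnr n x y : x • (y *+ n) = (x • y) *+ n.
Proof. by rewrite !jprodE !mulE mulrnDl. Qed.
Lemma jprod0r x : x • 0 = 0. Proof. by rewrite jprodE !mulE addr0. Qed.
Lemma jprod0l x : 0 • x = 0. Proof. by rewrite jprodE !mulE addr0. Qed.
Lemma jprodNr x y : x • (- y) = - (x • y).
Proof. by rewrite !jprodE !mulE; zmod. Qed.
Lemma jprodNl x y : (- x) • y = - (x • y).
Proof. by rewrite !jprodE !mulE; zmod. Qed.
Lemma jprodBl x y z : (x - y) • z = x • z - y • z.
Proof. by rewrite !jprodE !mulE; zmod. Qed.

Definition assoc x y z := (x · y) · z - x · (y · z).

(** Linearization of the left alternative law in its repeated argument. *)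
Lemma assocC12 x y z : assoc y x z = - assoc x y z.
Proof.
have := alt_left S (x + y) z; rewrite !mulE !alt_left => H.
by apply: (zlin 1 _ _ _ _ _ H) => //; rewrite /assoc; zmod.
Qed.

Lemma assocC23 x y z : assoc x z y = - assoc x y z.
Proof.
have := alt_right S (y + z) x; rewrite !mulE !alt_right => /esym H.
by apply: (zlin 1 _ _ _ _ _ H) => //; rewrite /assoc; zmod.
Qed.

(** * Peirce decomposition for a symmetric idempotent *)

Section Peirce.
Variable e : A.
Hypotheses (ee : e · e = e) (es : e^s = e).

Lemma idemLL x : e · (e · x) = e · x.
Proof. by rewrite -alt_left ee. Qed.
Lemma idemRR x : (x · e) · e = x · e.
Proof. by rewrite -alt_right ee. Qed.
Lemma idemLR x : e · (x · e) = (e · x) · e.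
Proof.
have := assocC23 e x e; rewrite /assoc ee idemLL subrr => /eqP.
by rewrite eq_sym oppr_eq0 subr_eq0 => /eqP.
Qed.

(** The booleans record the eigenvalues, 1 or 0, of left and right multiplication by [e]; as Peirce
    indices [true] stands for 1 and [false] for 2. *)
Definition peirce (i j : bool) (x : A) :=
  e · x = (if i then x else 0) /\ x · e = (if j then x else 0).

Lemma peirceD i j x y : peirce i j x -> peirce i j y -> peirce i j (x + y).
Proof.
rewrite /peirce !mulE => -[-> ->] [-> ->].
by case: i; case: j; rewrite ?addr0.
Qed.

Lemma peirceN i j x : peirce i j x -> peirce i j (- x).
Proof.
by rewrite /peirce !mulE => -[-> ->]; case: i; case: j; rewrite ?oppr0.
Qed.

Lemma peirce_star i j x : peirce i j x -> peirce j i x^s.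
Proof.
rewrite /peirce => -[ex xe]; split; rewrite -{1}es -astarM ?ex ?xe.
  by case: j {xe}; rewrite ?astar0.
by case: i {ex}; rewrite ?astar0.
Qed.

Lemma peirce_inj i j k l x :
  peirce i j x -> peirce k l x -> (i, j) != (k, l) -> x = 0.
Proof.
by move=> [ex xe] []; rewrite ex xe; move: i j k l {ex xe} => [] [] [] [].
Qed.

Lemma peirce_dec x : exists x11 x12 x21 x22,
  [/\ x = x11 + (x12 + x21) + x22, peirce true true x11, peirce true false x12,
      peirce false true x21 & peirce false false x22].
Proof.
exists ((e · x) · e), (e · x - (e · x) · e), (x · e - (e · x) · e),
  (x - e · x - x · e + (e · x) · e).
by split; rewrite /peirce ?mulE ?idemRR -?idemLR ?idemLL ?idemRR;
  [zmod | split; zmod..].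
Qed.

(* Says that the deviation of B from associativity alternates when one argument
   is e; both the product and the Leibniz defect of Phi have this property. *)
Definition peirce_rel (B : A -> A -> A) := forall x y,
  B (e · x) y - e · B x y = B x (e · y) - B (x · e) y /\
  B (e · x) y - e · B x y = B x y · e - B x (y · e).

(** Left multiplication by [e] is idempotent, so 2 is not an eigenvalue; the next three lemmas are
    analogous. *)
Lemma idem_eigen2 z : e · z = z *+ 2 -> z = 0.
Proof.
move=> ez; have := idemLL z; rewrite ez mulE ez => H.
by apply: (zlin 2 _ _ _ _ _ H) => //; zmod.
Qed.
Lemma idem_eigen2r z : z · e = z *+ 2 -> z = 0.
Proof.
move=> ez; have := idemRR z; rewrite ez mulE ez => H.
by apply: (zlin 2 _ _ _ _ _ H) => //; zmod.
Qed.
Lemma idem_eigenN1 z : e · z = - z -> z = 0.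
Proof.
move=> ez; have := idemLL z; rewrite ez mulE ez => H.
by apply: (zlin 2 _ _ _ _ _ H) => //; zmod.
Qed.
Lemma idem_eigenN1r z : z · e = - z -> z = 0.
Proof.
move=> ez; have := idemRR z; rewrite ez mulE ez => H.
by apply: (zlin 2 _ _ _ _ _ H) => //; zmod.
Qed.

Section Rel.
Variable B : A -> A -> A.
Hypotheses (B0l : forall y, B 0 y = 0) (B0r : forall x, B x 0 = 0).
Hypothesis BP : peirce_rel B.

(** On Peirce components [peirce_rel] can be solved for [e · B x y] and [B x y · e]. The resulting
    eigenvalues i + j - k and k + l - j yield all multiplication rules below. *)
Lemma peirce_rel_eigen i j k l x y : peirce i j x -> peirce k l y ->
  e · B x y = B x y *+ i + B x y *+ j - B x y *+ k /\
  B x y · e = B x y *+ k + B x y *+ l - B x y *+ j.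
Proof.
move=> [ex xe] [ey ye]; have [] := BP x y; rewrite ex xe ey ye.
have if0l (b : bool) : B (if b then x else 0) y = B x y *+ b by case: b.
have if0r (b : bool) : B x (if b then y else 0) = B x y *+ b by case: b.
rewrite !if0l !if0r => H1 H2.
have H3 := esym (etrans (esym H1) H2).
move: i j k l {ex xe ey ye} H1 H2 H3.
by move=> [] [] [] [] H1 H2 H3;
  (split; [apply: (zlin 1 _ _ _ _ _ (esym H1)) | apply: (zlin 1 _ _ _ _ _ H3)]);
  rewrite //; zmod.
Qed.

Lemma peirce_mul i j l x y :
  peirce i j x -> peirce j l y -> peirce i l (B x y).
Proof.
move=> Px Py; have [He eH] := peirce_rel_eigen _ _ _ _ _ _ Px Py.
split; rewrite ?He ?eH; case: (i) (j) (l) => [] [] []; zmod.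
Qed.

Lemma peirce_sq i x y :
  peirce i (~~ i) x -> peirce i (~~ i) y -> peirce (~~ i) i (B x y).
Proof.
move=> Px Py; have [He eH] := peirce_rel_eigen _ _ _ _ _ _ Px Py.
split; rewrite ?He ?eH; case: (i) => /=; zmod.
Qed.

(** In each of these cases one of the two eigenvalues is 2 or -1, which an idempotent does not
    admit. *)
Lemma peirce_orth i j k l x y : peirce i j x -> peirce k l y ->
  j != k -> (i, j) != (k, l) -> B x y = 0.
Proof.
move=> Px Py; have [] := peirce_rel_eigen _ _ _ _ _ _ Px Py.
move: i j k l {Px Py} => [] [] [] [] //= He eH _ _.
- by apply: idem_eigen2; rewrite He; zmod.
- by apply: idem_eigen2; rewrite He; zmod.
- by apply: idem_eigen2r; rewrite eH; zmod.
- by apply: idem_eigenN1r; rewrite eH; zmod.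
- by apply: idem_eigenN1; rewrite He; zmod.
- by apply: idem_eigenN1; rewrite He; zmod.
Qed.
End Rel.

Lemma amul_peirce_rel : peirce_rel (amul S).
Proof.
move=> x y; have H1 := assocC12 e x y; have H2 := assocC23 x e y.
split; first by apply: (zlin 1 _ _ _ _ _ H1) => //; rewrite /assoc; zmod.
by apply: (zlin 1 _ _ _ _ _ (eqB _ _ _ _ H1 H2)) => //; rewrite /assoc; zmod.
Qed.


Lemma idemC : (one - e) · (one - e) = one - e.
Proof. by rewrite !mulE ee; zmod. Qed.
Lemma astar_idemC : (one - e)^s = one - e.
Proof. by rewrite !mulE es. Qed.

(** Multiplying the equation by [e] from either side shows that [e · x] and [x · e] both equal
    [(e · x) · e]. *)
Lemma eigen2_peirce x : e · x + x · e = x *+ 2 -> peirce true true x.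
Proof.
move=> H; have H1 : (e · x) · e = e · x.
  have /= := congr1 (amul S e) H; rewrite !mulE idemLL idemLR => H1.
  by apply: (zlin 1 _ _ _ _ _ H1) => //; zmod.
have H2 : (e · x) · e = x · e.
  have /= := congr1 (fun z => z · e) H; rewrite !mulE idemRR => H2.
  by apply: (zlin 1 _ _ _ _ _ H2) => //; zmod.
rewrite /peirce -H2 H1; rewrite -H2 H1 in H; split.
  by apply: (zlin 2 _ _ _ _ _ H) => //; zmod.
by apply: (zlin 2 _ _ _ _ _ H) => //; zmod.
Qed.

(** The form in which (ii) is used: in [(x · a) · (one - e)] the components of [a] in A_21 and A_22
    are killed by [x], and the one in A_11 gives a product killed by [one - e]. *)
Lemma peirce11_eq0 x :
  (forall y, (forall a, (y · a) · (one - e) = 0) -> y = 0) ->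
  peirce true true x -> (forall c, peirce true false c -> x · c = 0) -> x = 0.
Proof.
move=> hii Px xc0; apply: hii => a.
have [a11 [a12 [a21 [a22 [-> P11 P12 P21 P22]]]]] := peirce_dec a.
have mulP := peirce_orth _ amul0l amul0r amul_peirce_rel.
rewrite !(amulDr, amulDl) (xc0 _ P12) (mulP _ _ _ _ _ _ Px P21) //.
rewrite (mulP _ _ _ _ _ _ Px P22) //.
have [_] := peirce_mul _ amul0l amul0r amul_peirce_rel _ _ _ _ _ Px P11.
by rewrite !mulE => ->; zmod.
Qed.

(** Adding the last two equations makes [z] skew. Then [z • e = 0] says that [z] commutes with [e],
    so [z] is twice [e · z], which forces it to vanish. *)
Lemma offdiag_eq0 z :
  e · z + z · e = z -> z • e = 0 -> z • (one - e) = 0 -> z = 0.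
Proof.
rewrite !jprodE !mulE => H1 H2 H3.
have zs : z^s = - z by apply: (zlin 1 _ _ _ _ _ (eqD _ _ _ _ H2 H3)) => //; zmod.
rewrite zs !mulE in H2.
have ez2 : (e · z) *+ 2 = z.
  by apply: (zlin 1 _ _ _ _ _ (eqB _ _ _ _ H1 H2)) => //; zmod.
have ez : e · z = 0.
  have /= := congr1 (amul S e) ez2; rewrite !mulE idemLL => H.
  by apply: (zlin 1 _ _ _ _ _ H) => //; zmod.
by rewrite -ez2 ez; zmod.
Qed.

End Peirce.

(** Transfers results on A_11 and A_12 to A_22 and A_21. *)
Lemma peirceC e i j x : peirce e i j x -> peirce (one - e) (~~ i) (~~ j) x.
Proof.
move=> [ex xe]; rewrite /peirce !mulE ex xe.
by split; [case: i {ex}|case: j {xe}] => /=; zmod.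
Qed.

(** * Additivity: the defect vanishes *)

Section Additivity.
Variable Phi : A -> A.
Hypothesis Phi0 : Phi 0 = 0.

Definition defect x y := Phi (x + y) - Phi x - Phi y.

Lemma defect0l y : defect 0 y = 0.
Proof. by rewrite /defect add0r Phi0; zmod. Qed.
Lemma defect0r y : defect y 0 = 0.
Proof. by rewrite /defect addr0 Phi0; zmod. Qed.
Lemma defectE x y : defect x y = 0 -> Phi (x + y) = Phi x + Phi y.
Proof. by move=> H; apply: (zlin 1 _ _ _ _ _ H) => //; rewrite /defect; zmod. Qed.
Lemma defectP x y : Phi (x + y) = Phi x + Phi y -> defect x y = 0.
Proof. by rewrite /defect => ->; zmod. Qed.

Hypothesis defect_jprodr : forall x y z,
  defect (x • y) (x • z) = x • defect y z.
Hypothesis defect_jprodl : forall x y z,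
  defect (x • z) (y • z) = defect x y • z.

Section Idempotent.
Variable e : A.
Hypotheses (ee : e · e = e) (es : e^s = e).

Lemma jprod_idem x : e • x = e · x + x · e.
Proof. by rewrite jprodE es. Qed.
Lemma jprod_idemC x : (one - e) • x = x *+ 2 - e • x.
Proof. by rewrite !jprodE !mulE es; zmod. Qed.
Lemma jprod_idem2 x : (e *+ 2 - one) • x = (e • x - x) *+ 2.
Proof. by rewrite !jprodE !mulE es; zmod. Qed.

(** Left Jordan multiplication by [one - e], [e *+ 2 - one] and [e] kills the eigenvalues 2, 1 and 0
    of [e • -] respectively. Killing either argument kills the defect, so the defect has two
    distinct eigenvalues at once. *)
Lemma defect_eigen21 x y : e • x = x *+ 2 -> e • y = y -> defect x y = 0.
Proof.
move=> ex ey; set D := defect x y.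
have H1 : (one - e) • D = 0.
  by rewrite -defect_jprodr jprod_idemC ex subrr defect0l.
have H2 : (e *+ 2 - one) • D = 0.
  by rewrite -defect_jprodr [X in defect _ X]jprod_idem2 ey subrr mul0rn defect0r.
move: H1 H2; rewrite jprod_idemC jprod_idem2 => H1 H2.
apply: (zlin 2 _ _ _ _ _ (eqD _ _ _ _ (eqD _ _ _ _ H1 H1) H2)) => //; zmod.
Qed.
Lemma defect_eigen20 x y : e • x = x *+ 2 -> e • y = 0 -> defect x y = 0.
Proof.
move=> ex ey; set D := defect x y.
have H1 : (one - e) • D = 0.
  by rewrite -defect_jprodr jprod_idemC ex subrr defect0l.
have H2 : e • D = 0 by rewrite -defect_jprodr ey defect0r.
move: H1; rewrite jprod_idemC H2 => H1.
apply: (zlin 2 _ _ _ _ _ H1) => //; zmod.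
Qed.
Lemma defect_eigen10 x y : e • x = x -> e • y = 0 -> defect x y = 0.
Proof.
move=> ex ey; set D := defect x y.
have H1 : (e *+ 2 - one) • D = 0.
  by rewrite -defect_jprodr jprod_idem2 ex subrr mul0rn defect0l.
have H2 : e • D = 0 by rewrite -defect_jprodr ey defect0r.
move: H1; rewrite jprod_idem2 H2 => H1.
apply: (zlin 2 _ _ _ _ _ (esym H1)) => //; zmod.
Qed.
Lemma defect_eigen210 x y z : e • x = x *+ 2 -> e • y = y -> e • z = 0 ->
  Phi (x + y + z) = Phi x + Phi y + Phi z.
Proof.
move=> ex ey ez; rewrite -(defectE x y) ?defect_eigen21 //; apply: defectE.
set D := defect _ _.
have H1 : e • D = 0 by rewrite -defect_jprodr ez defect0r.
(* This multiplier removes [y] and leaves a defect between multiples of [x] and [z]. *)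
have H2 : (e *+ 2 - one) • D = 0.
  rewrite -defect_jprodr !jprod_idem2 jprodDr ex ey ez defect_eigen20 //.
    by rewrite !(jprodDr, jprodMnr, jprodNr) ex ey; zmod.
  by rewrite !(jprodDr, jprodMnr, jprodNr) ez jprod0r; zmod.
move: H2; rewrite jprod_idem2 H1 => H2.
apply: (zlin 2 _ _ _ _ _ (esym H2)) => //; zmod.
Qed.

Lemma defect_eigen1 x y : e • x = x -> e • y = y -> e • defect x y = defect x y.
Proof. by move=> ex ey; rewrite -defect_jprodr ex ey. Qed.

Let mulP := peirce_mul e _ amul0l amul0r (amul_peirce_rel e).
Let mulSq := peirce_sq e _ amul0l amul0r (amul_peirce_rel e).
Let mul0P := peirce_orth e ee _ amul0l amul0r (amul_peirce_rel e).

Lemma jprod_peirce_diag x : peirce e true true x -> e • x = x *+ 2.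
Proof. by move=> [ex xe]; rewrite jprod_idem ex xe; zmod. Qed.
Lemma jprod_peirce_off i x : peirce e i (~~ i) x -> e • x = x.
Proof. by move=> [ex xe]; rewrite jprod_idem ex xe; case: i {ex xe} => /=; zmod. Qed.
Lemma jprod_peirce_diagC x : peirce e false false x -> e • x = 0.
Proof. by move=> [ex xe]; rewrite jprod_idem ex xe; zmod. Qed.

Lemma jprodl_peirce12 x : peirce e true false x -> x • e = 0.
Proof.
move=> Px; have [_ xe] := Px; have [ex _] := peirce_star e es _ _ _ Px.
by rewrite jprodE ex xe addr0.
Qed.
Lemma jprodlC_peirce21 x : peirce e false true x -> x • (one - e) = 0.
Proof.
move=> Px; have [_ xe] := Px; have [ex _] := peirce_star e es _ _ _ Px.
by rewrite jprodE !mulE ex xe; zmod.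
Qed.

(** The defect is off-diagonal; right Jordan multiplication by [e] kills its first argument, by
    [one - e] its second. *)
Lemma defect_1221 x y :
  peirce e true false x -> peirce e false true y -> defect x y = 0.
Proof.
move=> Px Py; apply: (offdiag_eq0 e ee).
- by rewrite -jprod_idem defect_eigen1 ?(jprod_peirce_off _ _ Px) ?(jprod_peirce_off _ _ Py).
- by rewrite -defect_jprodl jprodl_peirce12 ?defect0l.
by rewrite -defect_jprodl [X in defect _ X]jprodlC_peirce21 ?defect0r.
Qed.

(* x + y is the (1,2) component of (e + x) • (1 - e + y). *)
Lemma defect_1212 x y :
  peirce e true false x -> peirce e true false y -> defect x y = 0.
Proof.
move=> Px Py; have Pxs := peirce_star e es _ _ _ Px.
have Pxy := mulSq _ _ _ Px Py; have Pyx := mulP _ _ _ _ _ Py Pxs.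
have [ex xe] := Px; have [ey ye] := Py; have [exs xse] := Pxs.
have Pe : peirce e true true e by rewrite /peirce ee.
have PeC : peirce e false false (one - e) by rewrite /peirce !mulE ee subrr.
have d1 : defect e x = 0.
  by apply: defect_eigen21; [apply: jprod_peirce_diag|apply: jprod_peirce_off Px].
have d2 : defect (one - e) y = 0.
  have H : defect y (one - e) = 0.
    by apply: defect_eigen10; [apply: jprod_peirce_off Py|apply: jprod_peirce_diagC].
  by apply: defectP; rewrite (addrC _ y) (defectE _ _ H) (addrC (Phi y)).
have := defect_jprodr (e + x) (one - e) y; rewrite d2 jprod0r.
have -> : (e + x) • (one - e) = x + x^s by rewrite jprodE !mulE es ee exs xe; zmod.
have -> : (e + x) • y = y · x^s + (y + x · y).
  by rewrite jprodE !mulE es ey ye; zmod.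
have offE u v : peirce e true false u -> peirce e false true v -> e • (u + v) = u + v.
  by move=> Pu Pv; rewrite jprodDr (jprod_peirce_off _ _ Pu) (jprod_peirce_off _ _ Pv).
move/defectE; rewrite (defectE _ _ (defect_1221 _ _ Px Pxs)).
rewrite (defectE (y · x^s)); last first.
  by apply: defect_eigen21; [apply: jprod_peirce_diag | apply: offE].
rewrite (defectE _ _ (defect_1221 _ _ Py Pxy)).
(* Regrouped by Peirce spaces: A_11, A_12, and A_21, which contains [x · y] by [peirce_sq]. *)
have -> : x + x^s + (y · x^s + (y + x · y)) = y · x^s + ((x + y) + (x^s + x · y)).
  zmod.
rewrite (defectE (y · x^s)); last first.
  apply: defect_eigen21; first exact: jprod_peirce_diag.
  by apply: offE; apply: peirceD.
rewrite (defectE (x + y)); last by apply: defect_1221; apply: peirceD.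
move=> H; have {}H : defect x y + defect x^s (x · y) = 0.
  by apply: (zlin 1 _ _ _ _ _ H) => //; rewrite /defect; zmod.
apply: (offdiag_eq0 e ee).
- by rewrite -jprod_idem defect_eigen1 ?(jprod_peirce_off _ _ Px) ?(jprod_peirce_off _ _ Py).
- by rewrite -defect_jprodl jprodl_peirce12 // jprodl_peirce12 ?defect0l.
(* The new arguments lie in A_21, where right Jordan multiplication by [one - e] vanishes. *)
have -> : defect x y = - defect x^s (x · y).
  by apply: (zlin 1 _ _ _ _ _ H) => //; zmod.
rewrite -sub0r jprodBl jprod0l -defect_jprodl jprodlC_peirce21 //.
by rewrite jprodlC_peirce21 // defect0l subr0.
Qed.

(** Right multiplication by an element of A_12 moves both arguments into A_12, where additivity is
    known. *)
Lemma defect_1111 x y :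
  (forall z, (forall a, (z · a) · (one - e) = 0) -> z = 0) ->
  peirce e true true x -> peirce e true true y -> defect x y = 0.
Proof.
move=> hii Px Py.
have PD : peirce e true true (defect x y).
  apply: eigen2_peirce => //; rewrite -jprod_idem.
  have := defect_jprodr (one - e) x y.
  rewrite !jprod_idemC (jprod_peirce_diag _ Px) (jprod_peirce_diag _ Py) !subrr defect0l => H.
  by apply: (zlin 1 _ _ _ _ _ H) => //; zmod.
have xs0 z c : peirce e true true z -> peirce e true false c -> z • c = z · c.
  move=> Pz Pc; rewrite jprodE; have Pzs := peirce_star e es _ _ _ Pz.
  by rewrite (mul0P _ _ _ _ _ _ Pc Pzs) // addr0.
apply: (peirce11_eq0 e ee _ hii PD) => c Pc.
rewrite -xs0 // -defect_jprodl !xs0 //.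
by apply: defect_1212; [apply: mulP Px Pc | apply: mulP Py Pc].
Qed.
End Idempotent.

Lemma defect_eq0 e : e · e = e -> e^s = e ->
  (forall x, (forall a, (x · a) · e = 0) -> x = 0) ->
  (forall x, (forall a, (x · a) · (one - e) = 0) -> x = 0) ->
  forall x y, Phi (x + y) = Phi x + Phi y.
Proof.
move=> ee es hi hii x y.
have CC := idemC e ee; have Cs := astar_idemC e es.
have d11 u v : peirce e true true u -> peirce e true true v ->
    Phi (u + v) = Phi u + Phi v.
  by move=> Pu Pv; apply/defectE/(defect_1111 e).
(* For the idempotent [one - e], hypothesis (i) takes the place of (ii). *)
have d22 u v : peirce e false false u -> peirce e false false v ->
    Phi (u + v) = Phi u + Phi v.
  move=> /peirceC Pu /peirceC Pv; apply/defectE/(defect_1111 (one - e)) => // z hz.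
  by apply: hi => a; rewrite -[RHS](hz a); congr (_ · _); zmod.
have d12 u v : peirce e true false u -> peirce e true false v ->
    Phi (u + v) = Phi u + Phi v.
  by move=> Pu Pv; apply/defectE/(defect_1212 e).
have d21 u v : peirce e false true u -> peirce e false true v ->
    Phi (u + v) = Phi u + Phi v.
  by move=> /peirceC Pu /peirceC Pv; apply/defectE/(defect_1212 (one - e)).
have split u11 u12 u21 u22 : peirce e true true u11 -> peirce e true false u12 ->
    peirce e false true u21 -> peirce e false false u22 ->
    Phi (u11 + (u12 + u21) + u22) = Phi u11 + (Phi u12 + Phi u21) + Phi u22.
  move=> P11 P12 P21 P22; rewrite (defect_eigen210 e) //.
  - by rewrite (defectE u12) // (defect_1221 e).
  - exact: jprod_peirce_diag.
  - by rewrite jprodDr (jprod_peirce_off _ es _ _ P12) (jprod_peirce_off _ es _ _ P21).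
  exact: jprod_peirce_diagC.
have [x11 [x12 [x21 [x22 [-> ? ? ? ?]]]]] := peirce_dec e ee x.
have [y11 [y12 [y21 [y22 [-> ? ? ? ?]]]]] := peirce_dec e ee y.
have -> : x11 + (x12 + x21) + x22 + (y11 + (y12 + y21) + y22) =
  (x11 + y11) + ((x12 + y12) + (x21 + y21)) + (x22 + y22) by zmod.
rewrite split; try exact: peirceD.
by rewrite (d11 x11) // (d12 x12) // (d21 x21) // (d22 x22) // !split //; zmod.
Qed.
End Additivity.

(** * Additive derivations of the Jordan product are derivations of the algebra once they kill the
    unit *)

Section JordanStarDerivation.
Variable d : A -> A.
Hypothesis dD : forall x y, d (x + y) = d x + d y.
Hypothesis dJ : forall x y, d (x • y) = d x • y + x • d y.

Lemma additive_muln n x : d (x *+ n) = d x *+ n.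
Proof.
have d0 : d 0 = 0 by apply: (@addrI _ (d 0)); rewrite -dD !addr0.
by elim: n => [|n IHn]; rewrite ?mulr0n // !mulrS dD IHn.
Qed.
Lemma additive_opp x : d (- x) = - d x.
Proof.
apply: (@addrI _ (d x)); rewrite -dD !subrr.
exact: additive_muln 0%N x.
Qed.

Lemma derivation_one_idem e : e · e = e -> e^s = e ->
  (forall x, (forall a, (x · a) · (one - e) = 0) -> x = 0) ->
  (d one)^s = - d one -> (forall x, d one · x = x · d one) -> d one · e = 0.
Proof.
set t := d one => ee es hii ts tC.
have dsym x : x^s = x -> (d x)^s = d x - (t · x) *+ 2.
  move=> xs; have := dJ x one.
  rewrite !jprodE xs !mulE dD -/t -(tC x) => H.
  by apply: (zlin 1 _ _ _ _ _ (esym H)) => //; zmod.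
have etx x : x^s = x -> e · (t · x) = x · (t · e).
  move=> xs; have := dJ e x.
  have -> : e • x = x • e by rewrite !jprodE es xs addrC.
  rewrite dJ !jprodE es xs (dsym x xs) (dsym e es) !mulE => H.
  by apply: (zlin 2 _ _ _ _ _ (esym H)) => //; zmod.
have Pte : peirce e true true (t · e).
  by rewrite /peirce (idemRR _ ee) tC (idemLL _ ee).
have PtC : peirce e false false (t - t · e).
  by rewrite /peirce !mulE (idemRR _ ee) tC (idemLL _ ee) subrr.
have mulP := peirce_mul e _ amul0l amul0r (amul_peirce_rel e).
have mul0P := peirce_orth e ee _ amul0l amul0r (amul_peirce_rel e).
apply: (peirce11_eq0 e ee _ hii Pte) => a Pa.
have Pas := peirce_star e es _ _ _ Pa.
have tE x : t · x = (t · e) · x + (t - t · e) · x by rewrite !mulE; zmod.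
(* After the vanishing products are removed, [(t · e) · a] in A_12 equals [a^s · (t · e)] in A_21,
   so both are 0. *)
have := etx (a + a^s); rewrite !mulE (addrC a^s) => /(_ erefl).
rewrite (tE a) (tE a^s) (mul0P _ _ _ _ _ _ PtC Pa) //.
rewrite (mul0P _ _ _ _ _ _ Pte Pas) // (mul0P _ _ _ _ _ _ Pa Pte) //.
rewrite addr0 !add0r.
have [-> _] := mulP _ _ _ _ _ Pte Pa; have [-> _] := mulP _ _ _ _ _ PtC Pas.
rewrite addr0 => H; apply: (peirce_inj e _ _ _ _ _ (mulP _ _ _ _ _ Pte Pa)).
  by rewrite H; apply: mulP Pas Pte.
by [].
Qed.

Hypothesis d1 : d one = 0.

Lemma derivation_star x : d x^s = (d x)^s.
Proof.
have := dJ x one; rewrite !jprodE !mulE dD d1 !mulE => H.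
by apply: (zlin 1 _ _ _ _ _ H) => //; zmod.
Qed.

Definition leibniz_defect x y := d (x · y) - d x · y - x · d y.
Notation D := leibniz_defect.

Lemma leibniz_defectDl x y z : D (x + y) z = D x z + D y z.
Proof. by rewrite /D !(mulE, dD); zmod. Qed.
Lemma leibniz_defectDr x y z : D x (y + z) = D x y + D x z.
Proof. by rewrite /D !(mulE, dD); zmod. Qed.
Lemma leibniz_defect0l x : D 0 x = 0.
Proof. by apply: (@addrI _ (D 0 x)); rewrite -leibniz_defectDl !addr0. Qed.
Lemma leibniz_defect0r x : D x 0 = 0.
Proof. by apply: (@addrI _ (D x 0)); rewrite -leibniz_defectDr !addr0. Qed.

Lemma leibniz_defect_twist x y : D y x^s = - D x y.
Proof.
have := dJ x y; rewrite /D !jprodE derivation_star dD => H.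
by apply: (zlin 1 _ _ _ _ _ H) => //; zmod.
Qed.

(* The failure of d to be a derivation of the associator, hence alternating. *)
Definition leibniz_cobound x y z :=
  D (x · y) z + D x y · z - D x (y · z) - x · D y z.
Notation C := leibniz_cobound.

Lemma leibniz_coboundE x y z : C x y z =
  d (assoc x y z) - assoc (d x) y z - assoc x (d y) z - assoc x y (d z).
Proof. by rewrite /C /D /assoc !(mulE, dD, additive_opp); zmod. Qed.

Lemma leibniz_coboundC12 x y z : C y x z = - C x y z.
Proof.
rewrite !leibniz_coboundE (assocC12 x y) (assocC12 x (d y)) (assocC12 (d x) y).
by rewrite (assocC12 x y (d z)) additive_opp; zmod.
Qed.
Lemma leibniz_coboundC23 x y z : C x z y = - C x y z.
Proof.
rewrite !leibniz_coboundE (assocC23 x y) (assocC23 (d x) y) (assocC23 x (d y)).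
by rewrite (assocC23 x y (d z)) additive_opp; zmod.
Qed.

Section Idempotent.
Variable e : A.
Hypotheses (ee : e · e = e) (es : e^s = e).

Lemma leibniz_defect_idemr x : D x e = - D e x.
Proof. by rewrite -leibniz_defect_twist es. Qed.

(** Coboundaries with [e] in two slots vanish, which gives [Doff]; the twist makes [D e x] commute
    with [e]. Hence [e] acts on it by 1/2, impossible for an idempotent. *)
Lemma leibniz_defect_idem x : D e x = 0.
Proof.
have alt12 y : C e e y = 0.
  by apply: (zlin 2 _ _ _ _ _ (leibniz_coboundC12 e e y)) => //; zmod.
have alt23 y : C y e e = 0.
  by apply: (zlin 2 _ _ _ _ _ (leibniz_coboundC23 y e e)) => //; zmod.
have alt13 y : C e y e = 0 by rewrite leibniz_coboundC23 alt12 oppr0.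
have Dee : D e e = 0.
  by apply: (zlin 2 _ _ _ _ _ (leibniz_defect_idemr e)) => //; zmod.
have Dex y : D e (e · y) = D e y - e · D e y.
  have := alt12 y; rewrite /C ee Dee !(amul0l, amul0r) => H.
  by apply: (zlin 1 _ _ _ _ _ (esym H)) => //; zmod.
have Dxe y : D e (y · e) = D e y - D e y · e.
  have := alt23 y; rewrite /C ee Dee !leibniz_defect_idemr !(amulNl, amul0r) => H.
  by apply: (zlin 1 _ _ _ _ _ (esym H)) => //; zmod.
have Doff y : e · D e y + D e y · e = D e y.
  have := alt13 y; rewrite /C !leibniz_defect_idemr !amulNr Dex Dxe => H.
  by apply: (zlin 2 _ _ _ _ _ H) => //; zmod.
have Ds y : D e y^s = D e y by rewrite leibniz_defect_twist leibniz_defect_idemr opprK.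
have DC : e · D e x = D e x · e.
  have := Ds (e · x); rewrite astarM es Dxe Dex Ds => H.
  by apply: (zlin 1 _ _ _ _ _ H) => //; zmod.
have D2 : (e · D e x) *+ 2 = D e x.
  by rewrite -{2}(Doff x) DC; zmod.
have eD : e · D e x = 0.
  have := congr1 (amul S e) D2; rewrite amulMnr idemLL // => H.
  by apply: (zlin 1 _ _ _ _ _ H) => //; zmod.
by rewrite -D2 eD; zmod.
Qed.

Lemma leibniz_defect_peirce_rel : peirce_rel e D.
Proof.
move=> x y; have H1 := leibniz_coboundC12 e x y; have H2 := leibniz_coboundC23 x e y.
rewrite /C !(leibniz_defect_idemr, leibniz_defect_idem, oppr0, amul0l, amul0r) in H1 H2.
split; first by apply: (zlin 1 _ _ _ _ _ H1) => //; zmod.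
by apply: (zlin 1 _ _ _ _ _ (eqB _ _ _ _ H1 H2)) => //; zmod.
Qed.

Let DP := peirce_mul e D leibniz_defect0l leibniz_defect0r leibniz_defect_peirce_rel.
Let DSq := peirce_sq e D leibniz_defect0l leibniz_defect0r leibniz_defect_peirce_rel.
Let D0P := peirce_orth e ee D leibniz_defect0l leibniz_defect0r leibniz_defect_peirce_rel.

Lemma leibniz_defect_peirce i j k l x y : peirce e i j x -> peirce e k l y ->
  ~~ [&& i == j, j == k & k == l] -> D x y = 0.
Proof.
move=> Px Py nijkl; have Pxs := peirce_star e es _ _ _ Px.
have twist : D x y = - D y x^s by rewrite leibniz_defect_twist opprK.
have twist0 : D y x^s = 0 -> D x y = 0 by rewrite twist => ->; rewrite oppr0.
have [jk|jk] := eqVneq j k; last first.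
  (* Two elements of one off-diagonal space A_ij: [DSq] puts [D x y] in A_ji, the twist in A_ii. *)
  have [[ik jl]|] := eqVneq (i, j) (k, l); last exact: D0P Px Py jk.
  have ji : j = ~~ i by rewrite ik; case: (j) (k) jk => [] [].
  subst k l j; apply: (peirce_inj e _ _ _ _ _ (DSq _ _ _ Px Py)).
    by rewrite twist; apply/peirceN/(DP _ _ _ _ _ Py Pxs).
  by case: (i).
subst k; have Pxy := DP _ _ _ _ _ Px Py.
have [jl|jl] := eqVneq l j.
  subst l; have Pyx := peirceN _ _ _ _ (DP _ _ _ _ _ Py Pxs); rewrite -twist in Pyx.
  by apply: (peirce_inj e _ _ _ _ _ Pxy Pyx); move: nijkl; case: (i) (j) => [] [].
have [il|il] := eqVneq i l; last first.
  by apply/twist0/(D0P _ _ _ _ _ _ Py Pxs) => //; rewrite xpair_eqE eqxx eq_sym.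
(* Opposite off-diagonal spaces: [y] and [x^s] share a space, so the twist brings in [DSq]. *)
subst l; have ji : i = ~~ j by case: (i) (j) jl => [] [].
subst i; have := DSq _ _ _ Py Pxs => /peirceN; rewrite -twist => Pyx.
by apply: (peirce_inj e _ _ _ _ _ Pxy Pyx); case: (j).
Qed.

(** For [c] in A_12, swapping [y] and [c] in the coboundary leaves only [D x y · c], since every
    other term is a mixed defect or contains [c · y = 0]. *)
Lemma leibniz_defect_1111 x y :
  (forall z, (forall a, (z · a) · (one - e) = 0) -> z = 0) ->
  peirce e true true x -> peirce e true true y -> D x y = 0.
Proof.
move=> hii Px Py; apply: (peirce11_eq0 e ee _ hii (DP _ _ _ _ _ Px Py)) => c Pc.
have mulP := peirce_mul e _ amul0l amul0r (amul_peirce_rel e).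
have mul0P := peirce_orth e ee _ amul0l amul0r (amul_peirce_rel e).
have := leibniz_coboundC23 x y c; rewrite /C.
rewrite (mul0P _ _ _ _ _ _ Pc Py) // leibniz_defect0r.
rewrite (leibniz_defect_peirce _ _ _ _ _ _ (mulP _ _ _ _ _ Px Pc) Py) //.
rewrite (leibniz_defect_peirce _ _ _ _ _ _ Px Pc) //.
rewrite (leibniz_defect_peirce _ _ _ _ _ _ Pc Py) //.
rewrite (leibniz_defect_peirce _ _ _ _ _ _ (mulP _ _ _ _ _ Px Py) Pc) //.
rewrite (leibniz_defect_peirce _ _ _ _ _ _ Px (mulP _ _ _ _ _ Py Pc)) //.
rewrite (leibniz_defect_peirce _ _ _ _ _ _ Py Pc) // !(amul0r, amul0l) => H.
by apply: (zlin 1 _ _ _ _ _ H) => //; zmod.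
Qed.
End Idempotent.

Lemma leibniz_defect_eq0 e : e · e = e -> e^s = e ->
  (forall x, (forall a, (x · a) · e = 0) -> x = 0) ->
  (forall x, (forall a, (x · a) · (one - e) = 0) -> x = 0) ->
  forall x y, D x y = 0.
Proof.
move=> ee es hi hii x y.
have [x11 [x12 [x21 [x22 [-> P11 P12 P21 P22]]]]] := peirce_dec e ee x.
have [y11 [y12 [y21 [y22 [-> Q11 Q12 Q21 Q22]]]]] := peirce_dec e ee y.
have D11 : D x11 y11 = 0 by apply: leibniz_defect_1111 hii _ _.
have D22 : D x22 y22 = 0.
  apply: (leibniz_defect_1111 _ (idemC e ee) (astar_idemC e es)); last 2 first.
  - exact: (peirceC e false false).
  - exact: (peirceC e false false).
  by move=> z hz; apply: hi => a; rewrite -[RHS](hz a); congr (_ · _); zmod.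
have D0 := leibniz_defect_peirce e ee es.
rewrite !(leibniz_defectDl, leibniz_defectDr) D11 D22.
rewrite (D0 _ _ _ _ _ _ P11 Q12 isT) (D0 _ _ _ _ _ _ P11 Q21 isT) (D0 _ _ _ _ _ _ P11 Q22 isT).
rewrite (D0 _ _ _ _ _ _ P12 Q11 isT) (D0 _ _ _ _ _ _ P12 Q12 isT) (D0 _ _ _ _ _ _ P12 Q21 isT).
rewrite (D0 _ _ _ _ _ _ P12 Q22 isT) (D0 _ _ _ _ _ _ P21 Q11 isT) (D0 _ _ _ _ _ _ P21 Q12 isT).
rewrite (D0 _ _ _ _ _ _ P21 Q21 isT) (D0 _ _ _ _ _ _ P21 Q22 isT) (D0 _ _ _ _ _ _ P22 Q11 isT).
by rewrite (D0 _ _ _ _ _ _ P22 Q12 isT) (D0 _ _ _ _ _ _ P22 Q21 isT); zmod.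
Qed.
End JordanStarDerivation.

(** * Removing the extra term and the factor [N] from the derivation identity *)

Section PerturbedDerivation.
Variables (Phi : A -> A) (N c d : nat).
Hypothesis N_gt0 : (0 < N)%N.
Hypothesis PhiJ : forall x y, Phi ((x • y) *+ N) =
  ((Phi one *+ c + (Phi one)^s *+ d) • x) • y + (Phi x • y + x • Phi y) *+ N.

Lemma perturbed_zero : Phi 0 = 0.
Proof. by have := PhiJ 0 0; rewrite !(jprod0l, jprod0r, mul0rn, addr0). Qed.

Notation Delta := (defect Phi).

Lemma mulrnI_A (x y : A) : x *+ N = y *+ N -> x = y.
Proof. by move=> H; apply: (zlin N _ _ _ _ _ H) => //; rewrite mulrnBl. Qed.

Lemma perturbedE x y : Phi ((x • y) *+ N) =
  ((Phi one *+ c + (Phi one)^s *+ d) • x) • y + (Phi x • y) *+ N + (x • Phi y) *+ N.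
Proof. by rewrite PhiJ mulrnDl addrA. Qed.

Lemma perturbed_defectr_muln x y z :
  Delta ((x • y) *+ N) ((x • z) *+ N) = (x • Delta y z) *+ N.
Proof.
rewrite /defect -mulrnDl -jprodDr !perturbedE -[RHS]jprodMnr !mulrnBl.
by rewrite !(jprodDr, jprodNr, jprodMnr) mulrnDl; zmod.
Qed.
Lemma perturbed_defectl x y z : Delta (x • z) (y • z) = Delta x y • z.
Proof.
(* Dividing [z] by [N] produces the factor [N] that [PhiJ] requires inside [Phi]. *)
have -> : z = (N%:R^-1 *: z) *+ N.
  by rewrite -scaler_nat scalerA mulfV ?scale1r // Num.Theory.pnatr_eq0 -lt0n.
set w := _ *: _; rewrite /defect !(jprodDl, jprodNl) !jprodMnr -mulrnDl -jprodDl.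
rewrite !perturbedE; move: (_ *+ c + _) => T.
by rewrite (jprodDr T) !(jprodDl _ _ (Phi w)) (jprodDl _ _ w) (mulrnDl N (x • Phi w)); zmod.
Qed.

Lemma perturbed_defectr x y z : Delta (x • y) (x • z) = x • Delta y z.
Proof.
(* Multiplication by N commutes with the defect, being N times (1/2)1 • -. *)
pose u := (2%:R : algC)^-1 *: one.
have u2 : u + u = one.
  by rewrite -mulr2n -scaler_nat scalerA mulfV ?scale1r // Num.Theory.pnatr_eq0.
(* The involution is only assumed additive, so symmetry of [u] is drawn from [u + u = one]. *)
have us : u^s = u.
  have := congr1 (astar S) u2; rewrite astarD astar1 -u2 => H.
  by apply: (zlin 2 _ _ _ _ _ H) => //; zmod.
have uE v : u • v = v by rewrite jprodE us -[RHS](amul1l S) -u2 amulDl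
  !(amulZl, amulZr) amul1l amul1r.
apply: mulrnI_A; rewrite -perturbed_defectr_muln.
by have := perturbed_defectr_muln u (x • y) (x • z); rewrite !uE.
Qed.

Hypothesis PhiD : forall x y, Phi (x + y) = Phi x + Phi y.

(** Putting x = 1 gives [H1]; then y = 1 yields (2(c + d) + N) p = 0, hence p = 0. With t skew, [H1]
    reduces to N (t y - y t) = 0. *)
Lemma perturbed_one :
  (Phi one)^s = - Phi one /\ (forall x, Phi one · x = x · Phi one).
Proof.
set t := Phi one; set p := t + t^s.
have T1 : (t *+ c + t^s *+ d) • one = p *+ (c + d).
  rewrite jprodE !mulE /p mulrnDr !mulrnDl.
  by move: (t *+ c) (t^s *+ d) (t^s *+ c) (t *+ d) => q r u v; zmod.
have H1 y : p *+ (c + d) • y + (t • y) *+ N = 0.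
  have oneE z : one • z = z *+ 2 by rewrite jprodE !mulE.
  have := perturbedE one y; rewrite -/t T1 !oneE !(additive_muln Phi PhiD).
  move: (Phi y *+ 2 *+ N) ((t • y) *+ N) => q r H.
  by apply: (zlin 1 _ _ _ _ _ (esym H)) => //; zmod.
have t1 : t • one = p by rewrite jprodE !mulE.
have p1 : p • one = p *+ 2 by rewrite jprodE !mulE /p; zmod.
have p0 : p = 0.
  have := H1 one; rewrite jprodMnl p1 t1 -!mulrnA -mulrnDr.
  by apply: mulrn_inj0; rewrite addn_gt0 N_gt0 orbT.
have ts : t^s = - t by apply: (zlin 1 _ _ _ _ _ p0) => //; rewrite /p; zmod.
split=> // x; have := H1 x; rewrite p0 mul0rn jprod0l add0r jprodE ts mulE.
move/(mulrn_inj0 _ _ N_gt0) => H.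
by apply: (zlin 1 _ _ _ _ _ H) => //; zmod.
Qed.

Lemma perturbed_jordan x y : Phi (x • y) = Phi x • y + x • Phi y.
Proof.
have [ts tC] := perturbed_one.
apply: mulrnI_A; rewrite -(additive_muln _ PhiD) PhiJ [X in X • y](_ : _ = 0).
  by rewrite jprod0l add0r.
by rewrite jprodE !mulE ts !mulE tC !mulNrn; zmod.
Qed.
End PerturbedDerivation.

(** * Iterated Jordan products with leading units *)

Section JordanProducts.
Lemma jprodnS n a : jprodn S n.+2 a = jprodn S n.+1 a • a n.+1.
Proof.
rewrite /jprodn (_ : iota 1 n.+2.-1 = iota 1 n.+1.-1 ++ [:: n.+1]).
  by rewrite map_cat foldl_cat.
by rewrite -[[:: _]]/(iota (1 + n) 1) -iotaD addn1.
Qed.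

Lemma eq_jprodn n a b : (forall i, (i <= n)%N -> a i = b i) ->
  jprodn S n.+1 a = jprodn S n.+1 b.
Proof.
elim: n => [|n IHn] eq_ab; first by rewrite /jprodn /= eq_ab.
by rewrite !jprodnS IHn ?eq_ab // => i le_in; rewrite eq_ab // leqW.
Qed.

Lemma jprodn_one n : jprodn S n.+1 (fun=> one) = one *+ 2 ^ n.
Proof.
elim: n => [|n IHn]; first by [].
by rewrite jprodnS IHn jprodMnl jprodE !mulE -mulr2n -mulrnA -expnS.
Qed.

Lemma jprodn_tail n a : (forall i, (i < n)%N -> a i = one) ->
  jprodn S n.+2 a = (a n • a n.+1) *+ 2 ^ n.
Proof.
case: n => [|n] a1; first by [].
rewrite !jprodnS (@eq_jprodn _ _ (fun=> one)); last by move=> i; apply: a1.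
have one2 x : one • x = x *+ 2 by rewrite jprodE !mulE.
by rewrite jprodn_one !jprodMnl one2 jprodMnl -mulrnA -expnS.
Qed.

(** These are the summands in which [Phi] hits a leading unit. Each prefix is a combination of [t]
    and [t^s], because 1 • t = 2 t and z • 1 = z + z^s. *)
Lemma jprodn_ones_sum n t : exists c d, forall x y,
  \sum_(k < n) jprodn S n.+2
     (fun i => if i == k then t else if (i < n)%N then one
               else if i == n then x else y)
  = ((t *+ c + t^s *+ d) • x) • y.
Proof.
pose b (k i : nat) := if i == k then t else one.
have bE m k : (k <= m)%N -> exists c d, jprodn S m.+1 (b k) = t *+ c + t^s *+ d.
  elim: m => [|m IHm] le_km.
    by exists 1%N, 0%N; rewrite /jprodn /b /= eq_sym -leqn0 le_km addr0.
  have [->|ne_km] := eqVneq k m.+1.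
    exists (2 ^ m.+1)%N, 0%N; rewrite jprodnS /b eqxx.
    rewrite (@eq_jprodn _ _ (fun=> one)) => [|i le_im]; last by rewrite ltn_eqF.
    by rewrite jprodn_one jprodMnl jprodE !mulE addr0 -mulr2n -mulrnA expnS.
  have [|u [v IH]] := IHm; first by rewrite -ltnS ltn_neqAle ne_km.
  (* A further unit on the right symmetrizes the prefix, so both coefficients become u + v. *)
  exists (u + v)%N, (u + v)%N; rewrite jprodnS IH /b eq_sym (negPf ne_km).
  rewrite jprodE !mulE !mulrnDr.
  by move: (t *+ u) (t *+ v) (t^s *+ u) (t^s *+ v) => p q r s; zmod.
have sumE : exists c d, \sum_(k < n) jprodn S n (b k) = t *+ c + t^s *+ d.
  case: n => [|n]; first by exists 0%N, 0%N; rewrite big_ord0 addr0.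
  have : forall k : 'I_n.+1, (k <= n)%N by move=> k; rewrite -ltnS.
  elim/big_rec: _ => [|k z _ IH] le_n; first by exists 0%N, 0%N; rewrite addr0.
  have [u [v ->]] := IH le_n; have [u' [v' ->]] := bE n k (le_n k).
  exists (u' + u)%N, (v' + v)%N; rewrite !mulrnDr.
  by move: (t *+ u) (t *+ u') (t^s *+ v) (t^s *+ v') => p q r s; zmod.
have [c [d cd]] := sumE; exists c, d => x y; rewrite -cd.
rewrite (big_morph (fun z => z • x) (fun z w => jprodDl z w x) (jprod0l x)).
rewrite (big_morph (fun z => z • y) (fun z w => jprodDl z w y) (jprod0l y)).
case: n {bE sumE cd} => [|n]; first by rewrite !big_ord0.
apply: eq_bigr => k _; rewrite !jprodnS.
rewrite (@eq_jprodn _ _ (b k)) => [|i le_in]; last by rewrite /b ltnS le_in.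
have lt_kn := ltn_ord k.
by rewrite !(gtn_eqF (leqW lt_kn)) (gtn_eqF lt_kn) !ltnn eqxx ltnNge leqnSn gtn_eqF.
Qed.
End JordanProducts.
End Algebra.

(** * From the hypothesis on n-fold products to the conclusion *)

Theorem theorem1 (A : lmodType algC) (S : alt_star_algebra A) (n : nat)
  (hn : (2 <= n)%N) (e : A)
  (he2 : amul S e e = e) (hes : astar S e = e)
  (he0 : e != 0) (he1 : e != aone S)
  (hi : forall x : A, (forall a : A, amul S (amul S x a) e = 0) -> x = 0)
  (hii : forall x : A,
      (forall a : A, amul S (amul S x a) (aone S - e) = 0) -> x = 0)
  (Phi : A -> A)
  (hPhi : forall x y : A,
      let a := fun i : nat =>
        if (i < n - 2)%N then aone S else if i == (n - 2)%N then x else y in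
      Phi (jprodn S n a) =
      \sum_(k < n) jprodn S n (fun i => if i == k then Phi (a i) else a i)) :
  additive_star_derivation S Phi.
Proof.
case: n hn hPhi => [|[|n]] // _ hPhi.
have [c [d cdE]] := jprodn_ones_sum A S n (Phi (aone S)).
have N0 : (0 < 2 ^ n)%N by rewrite expn_gt0.
have PhiJ x y : Phi (jprod S x y *+ 2 ^ n) =
    jprod S (jprod S (Phi (aone S) *+ c + astar S (Phi (aone S)) *+ d) x) y +
    (jprod S (Phi x) y + jprod S x (Phi y)) *+ 2 ^ n.
  have := hPhi x y; rewrite !subSS subn0 /= jprodn_tail => [|i ->//].
  rewrite ltnn eqxx ltnNge leqnSn gtn_eqF // => ->.
  (* The last two summands, where [Phi] hits x or y, are split off. From here on [n] is the number
     of leading units. *)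
  rewrite !big_ord_recr /= -cdE -addrA; congr (_ + _).
    apply: eq_bigr => k _; apply: eq_jprodn => i _ /=.
    by case: eqP => // ->; rewrite ltn_ord.
  rewrite !jprodn_tail /= => [|i lt_in|i lt_in].
  - have [nS Sn nS_lt] : [/\ (n.+1 == n) = false, (n == n.+1) = false & (n.+1 < n)%N = false].
      by rewrite (gtn_eqF (ltnSn n)) (ltn_eqF (ltnSn n)) ltnNge leqnSn.
    by rewrite !(nS, Sn, nS_lt, eqxx, ltnn) -mulrnDl.
  - by rewrite (ltn_eqF (leqW lt_in)) lt_in.
  by rewrite (ltn_eqF lt_in) lt_in.
have Phi0 := perturbed_zero A S Phi _ _ _ PhiJ.
have dr := perturbed_defectr A S Phi _ _ _ N0 PhiJ.
have dl := perturbed_defectl A S Phi _ _ _ N0 PhiJ.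
have PhiD := defect_eq0 A S Phi Phi0 dr dl e he2 hes hi hii.
have dJ := perturbed_jordan A S Phi _ _ _ N0 PhiJ PhiD.
have [ts tC] := perturbed_one A S Phi _ _ _ N0 PhiJ PhiD.
have t0 : Phi (aone S) = 0.
  have te := derivation_one_idem A S Phi PhiD dJ e he2 hes hii ts tC.
  (* The same lemma for the complementary idempotent kills the other half of t = t (1 - e) + t e. *)
  have teC := derivation_one_idem A S Phi PhiD dJ _ (idemC A S e he2) (astar_idemC A S e hes).
  rewrite -[Phi _](amul1r S) -[X in amul S _ X](subrK e) amulDr te addr0.
  apply: teC => // x hx; apply: hi => a; rewrite -[RHS](hx a).
  by congr (amul S _ _); zmod.
split=> //; split; last exact: derivation_star.
move=> a b; have := leibniz_defect_eq0 A S Phi PhiD dJ t0 e he2 hes hi hii a b.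
by move=> H; apply: (zlin A 1 _ _ _ _ _ H) => //; rewrite /leibniz_defect; zmod.
Qed.
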